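(* Let $\lambda,\mu,\nu$ be partitions of $n$ and let $i$ be a positive integer with $i\le\min\{\ell(\lambda),\ell(\mu)\}$. If $\lambda_i-\lambda_{i+1}\ge{\sf d}(\nu)$ and $\mu_i-\mu_{i+1}\ge{\sf d}(\nu)$, then for all positive integers $k$ we have $$ {\sf g}(\lambda^{(i,k)},\mu^{(i,k)},\nu^{(1,ki)}) = {\sf g}(\lambda,\mu,\nu). $$
   Context: ${\sf g}(\lambda,\mu,\nu)=\langle\chi^\lambda\otimes\chi^\mu,\chi^\nu\rangle$ is the Kronecker coefficient, with $\chi^\lambda$ the irreducible character of ${\sf S}_n$ attached to the partition $\lambda$ of $n$. $\ell(\lambda)$ is the number of parts of $\lambda$, with $\lambda_j=0$ for $j>\ell(\lambda)$. The depth of $\nu$ is ${\sf d}(\nu)=|\nu|-\nu_1$. For a partition $\mu=(\mu_1,\dots,\mu_q)$, a positive integer $k$ and $1\le i\le q$, $\mu^{(i,k)}=(\mu_1+k,\dots,\mu_i+k,\mu_{i+1},\dots,\mu_q)$. *)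

(* Defs.v *)
From mathcomp Require Import all_boot all_order all_algebra.
From mathcomp Require Import all_fingroup all_solvable all_field all_character.

Set Implicit Arguments.
Unset Strict Implicit.
Unset Printing Implicit Defensive.

Import GroupScope GRing.Theory.

Local Open Scope nat_scope.

(* Partitions are weakly decreasing sequences of positive integers, numbered
   from 0: the j-th part lambda_j of a partition la is [nth 0 la j.-1], which
   is 0 for j > size la. *)
Definition is_partition_of (n : nat) (la : seq nat) : bool :=
  [&& sorted geq la, 0 \notin la & sumn la == n].

Definition conj_part (la : seq nat) : seq nat :=
  mkseq (fun j => count (fun p => j < p) la) (head 0 la).

Definition depth (nu : seq nat) : nat := sumn nu - head 0 nu.

Definition add_first_parts (i k : nat) (mu : seq nat) : seq nat :=
  [seq p + k | p <- take i mu] ++ drop i mu.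

(* For sumn a = n, [reshape_index a x] is the index of the block containing x
   when 0, ..., n - 1 is cut into consecutive blocks of sizes a_1, a_2, ...;
   the Young subgroup S_a consists of the permutations preserving each block. *)
Definition young_set (n : nat) (a : seq nat) : {set 'S_n} :=
  [set s : 'S_n | [forall x, reshape_index a (s x) == reshape_index a x]].

Fact young_group_set (n : nat) (a : seq nat) : group_set (young_set n a).
Proof.
apply/group_setP; split=> [|s t]; first by rewrite inE; apply/forallP=> x; rewrite perm1.
rewrite !inE => /forallP hs /forallP ht; apply/forallP=> x.
by rewrite permM (eqP (ht _)).
Qed.

Canonical young_group (n : nat) (a : seq nat) : {group 'S_n} :=
  Group (young_group_set n a).

Fact cfSgn_subproof (n : nat) (G : {group 'S_n}) :
  is_class_fun <<G>> [ffun s : 'S_n => ((-1) ^+ (odd_perm s) *+ (s \in G) : algC)%R].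
Proof.
rewrite genGid; apply: intro_class_fun => [s t sG tG | s /negbTE->]; last by [].
by rewrite odd_permJ groupJr.
Qed.

Definition cfSgn (n : nat) (G : {group 'S_n}) : 'CF(G) :=
  Cfun 0 (@cfSgn_subproof n G).

(* The irreducible character chi^la of S_n, as defined by James and Kerber: the
   unique common irreducible constituent of the trivial character of S_la and
   of the sign character of S_la', both induced to S_n, where la' is the
   conjugate partition. (Thus chi^(n) is the trivial character and chi^(1^n) is
   the sign.) The default 0 is never reached when la is a partition of n. *)
Definition irr_part_index (n : nat) (la : seq nat) : Iirr [set: 'S_n] :=
  odflt 0%R
    [pick j |
       (j \in irr_constt ('Ind[[set: 'S_n]] (1 : 'CF(young_group n la)))%R)
    && (j \in irr_constt
                ('Ind[[set: 'S_n]] (cfSgn (young_group n (conj_part la))))%R)].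

Definition irr_part (n : nat) (la : seq nat) : 'CF([set: 'S_n]) :=
  ('chi_(irr_part_index n la))%R.

Definition kronecker (n : nat) (la mu nu : seq nat) : algC :=
  '[irr_part n la * irr_part n mu, irr_part n nu]%R.

(* Main.v *)
Require Import Defs.
From mathcomp Require Import all_boot all_order all_algebra.
From mathcomp Require Import all_fingroup all_field all_character.
From mathcomp Require Import zify ring mpoly.

(** Let phi^a be the permutation character of the symmetric group on the words
    of content [a], and let delta = (N - 1, ..., 1, 0).  The proof turns the
    Kronecker coefficient into an explicit signed count in which every single
    term is stable.

    The character of a partition is given by the Jacobi-Trudi formula: chi^la
    is the sum over [s] of sgn(s) phi^(la_i - i + s(i)) ([irr_part_jt]).  The
    average over the group of a product of three characters phi^a phi^b phi^c
    is, by Burnside's lemma, the number of three-dimensional arrays of natural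
    numbers with margins [a], [b], [c] ([sum_num_fixed3]).  Expanding all three
    characters, g(la, mu, nu) becomes a signed count of arrays.  Fix, in such an
    array, all slices in the third direction except the first one, and let [x]
    and [y] be the row and column sums of the fixed part.  The first slice is
    then a matrix with margins la - x + delta - s delta and
    mu - y + delta - t delta, to be summed with the signs of [s] and [t].
    Cauchy's determinant evaluates this sum: it is the signed number of the
    permutations [p] carrying la - x + delta to mu - y + delta
    ([cauchy_margins]).  The result is [kronecker_straightening].

    The first part of the composition nu_j - j + q(j) is at least nu_1, so the
    fixed slices have total at most d(nu), and every entry of [x] and [y] is
    at most d(nu).  The gap hypotheses then say that the first [i] entries of
    la - x + delta exceed all the others, and likewise for mu - y + delta.
    Hence [p] preserves the set of the first [i] positions, and adding [k] to
    these entries on both sides neither creates nor destroys a matching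
    ([straightens_add_first]).  The arrays of slices are constrained only by the
    parts of nu after the first, which do not change, so the two signed sums
    agree term by term.

    For the Jacobi-Trudi formula, the same signed count with the trivial
    character as third factor shows that the alternating sum has norm 1.  In
    its expansion only the diagonal term phi^la meets the sign character
    induced from the column subgroup, as the other terms are indexed by
    compositions strictly dominating [la] ([jt_index_block_injective]).  So its
    scalar product with a common constituent of phi^la and of that induced
    sign character is a positive integer, and a virtual character of norm 1
    with this property is that constituent. *)

Set Implicit Arguments.
Unset Strict Implicit.
Unset Printing Implicit Defensive.

Import Order.TTheory GRing.Theory Num.Theory.
Local Open Scope ring_scope.

(** * The Cauchy determinant *)

(** The entries of Cauchy's matrix are homogenized values of split monic
    polynomials, which exhibits it as a product of an alternant and a matrix of
    coefficients. *)
Lemma horner_homogenize (R : comNzRingType) (I : Type) (s : seq I) (y : I -> R)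
    (x z : R) :
  \sum_(k < (size s).+1) (\prod_(l <- s) ('X - (y l)%:P))`_k
     * (z ^+ k * x ^+ (size s - k))
  = \prod_(l <- s) (z - x * y l).
Proof.
elim: s => [|l s IHs] /=.
  by rewrite big_ord1 !big_nil coefC eqxx !expr0 !mulr1.
rewrite !big_cons -IHs; set p := \prod_(j <- s) _.
have szp : (size p <= (size s).+1)%N by rewrite size_prod_XsubC.
rewrite [RHS]mulrBl; under eq_bigr => k _ do
  rewrite (mulrBl p) coefB coefXM coefCM mulrBl.
rewrite sumrB big_ord_recl /= mul0r add0r; congr (_ - _).
  rewrite mulr_sumr; apply: eq_bigr => k _.
  by rewrite subSS exprS; ring.
rewrite big_ord_recr /= [p`_(size s).+1]nth_default // mulr0 mul0r addr0 mulr_sumr.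
apply: eq_bigr => k _; rewrite subSn ?exprS -1?ltnS //; ring.
Qed.

(** Exponents decrease, so that the determinant is the signed sum of the
    monomials x^(s delta), in the notation of the Jacobi-Trudi indices. *)
Definition alternant (R : comNzRingType) (N : nat) (x : 'I_N -> R) : 'M[R]_N :=
  \matrix_(i, j) x i ^+ (N.-1 - j).

(** Reversing both the rows and the columns yields a Vandermonde matrix without
    changing the determinant. *)
Lemma det_alternant (R : comNzRingType) (N : nat) (x : 'I_N -> R) :
  \det (alternant x) = \prod_(i < N) \prod_(j < N | (i < j)%N) (x i - x j).
Proof.
pose r : 'S_N := perm (@rev_ord_inj N).
have rE i : (r i = N - i.+1 :> nat)%N by rewrite permE.
have -> : alternant x =
    row_perm r (col_perm r (Vandermonde N (\row_j x (r j)))^T).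
  apply/matrixP=> i j; rewrite !mxE rE.
  have -> : r (r i) = i by rewrite !permE rev_ordK.
  by congr (_ ^+ _); lia.
rewrite row_permE col_permE !det_mulmx det_tr !det_perm det_Vandermonde.
rewrite odd_permV mulrA mulrAC -signr_addb addbb mul1r.
under eq_bigr => i _ do under eq_bigr => j _ do rewrite !mxE.
rewrite (exchange_big_dep xpredT) //= (reindex_inj (@perm_inj _ r)) /=.
apply: eq_bigr => i _; rewrite (reindex_inj (@perm_inj _ r)) /=.
apply: eq_big => j; first by rewrite !rE; have := ltn_ord i; have := ltn_ord j; lia.
by rewrite !permE !rev_ordK.
Qed.

(** This is Cauchy's determinant with its denominators cleared.  The matrix is
    the product of the alternant of [x] and the matrix [C] whose column [j] lists
    the coefficients of q_j, the product of the X - y_l over l <> j.  As q_j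
    vanishes at all y_l but y_j, the product of the Vandermonde matrix of [y] and
    [C] is diagonal; cancelling the Vandermonde determinant gives det C. *)
Lemma cauchy_determinant (R : idomainType) (N : nat) (x y : 'I_N -> R) :
  injective y ->
  \det (\matrix_(i, j) \prod_(l | l != j) (1 - x i * y l))
  = \det (alternant x) * \det (alternant y).
Proof.
move=> injy.
pose q j := \prod_(l <- filter (predC1 j) (index_enum 'I_N)) ('X - (y l)%:P).
have sz j : size (filter (predC1 j) (index_enum 'I_N)) = N.-1.
  have := rem_filter j (index_enum_uniq 'I_N) => <-.
  rewrite size_rem ?mem_index_enum //.
  by rewrite -[N in RHS]card_ord cardE enumT [index_enum _]unlock.
have homq j a b : \sum_(k < N) (q j)`_k * (b ^+ k * a ^+ (N.-1 - k))
    = \prod_(l | l != j) (b - a * y l).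
  rewrite -big_filter -horner_homogenize sz prednK //.
  by case: (N) j => // -[].
pose C := \matrix_(k < N, j < N) (q j)`_k.
have -> : \matrix_(i, j) \prod_(l | l != j) (1 - x i * y l) = alternant x *m C.
  apply/matrixP=> i j; rewrite !mxE -homq; apply: eq_bigr => k _.
  by rewrite !mxE expr1n mul1r mulrC.
rewrite det_mulmx; congr (_ * _).
have VC : (Vandermonde N (\row_j y j))^T *m C
    = diag_mx (\row_j \prod_(l | l != j) (y j - y l)).
  apply/matrixP=> i j; rewrite !mxE.
  transitivity (\prod_(l | l != j) (y i - y l)).
    under [RHS]eq_bigr => l _ do rewrite -[y l]mul1r.
    rewrite -homq; apply: eq_bigr => k _.
    by rewrite !mxE expr1n mulr1 mulrC.
  have [->|ij] := eqVneq i j; first by rewrite mulr1n.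
  by rewrite (bigD1 i) //= subrr mul0r mulr0n.
have := congr1 determinant VC; rewrite det_mulmx det_tr det_diag.
set V := \det (Vandermonde _ _).
have Vneq0 : V != 0.
  rewrite /V det_Vandermonde; apply/prodf_neq0=> i _; apply/prodf_neq0=> j ij.
  rewrite !mxE subr_eq0; apply/eqP=> /injy ji.
  by rewrite ji ltnn in ij.
move=> VCE; apply: (mulfI Vneq0); rewrite VCE {VCE} det_alternant.
rewrite /V det_Vandermonde.
under eq_bigr => i _ do rewrite mxE (bigID (fun l : 'I_N => (l < i)%N)) /=.
rewrite big_split /=; congr (_ * _).
  rewrite (exchange_big_dep xpredT) //=; apply: eq_bigr => i _.
  apply: eq_big => j; last by rewrite !mxE.
  by rewrite -val_eqE /=; case: ltngtP.
apply: eq_bigr => i _; apply: eq_bigl => j.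
by rewrite -val_eqE /= -leqNgt; case: ltngtP.
Qed.

(** * Matrices with prescribed margins *)

Lemma big_pairs (R : Type) (idx : R) (op : Monoid.com_law idx) (I J : finType)
    (F : I * J -> R) :
  \big[op/idx]_c F c = \big[op/idx]_i \big[op/idx]_j F (i, j).
Proof. by rewrite pair_bigA; apply: eq_bigr => -[]. Qed.

Section Alphabets.

Variable N : nat.
Local Notation R := {mpoly int[N + N]}.

Definition xvar (i : 'I_N) : R := 'X_(lshift N i).
Definition yvar (j : 'I_N) : R := 'X_(rshift N j).

Definition biexp (U V : 'I_N -> nat) : 'X_{1..N + N} :=
  [multinom match split k with inl i => U i | inr j => V j end | k < N + N].

Lemma biexp_lshift U V i : biexp U V (lshift N i) = U i.
Proof. by rewrite mnmE (unsplitK (inl i)). Qed.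

Lemma biexp_rshift U V j : biexp U V (rshift N j) = V j.
Proof. by rewrite mnmE (unsplitK (inr j)). Qed.

Lemma prod_xyvar U V :
  (\prod_i xvar i ^+ U i) * (\prod_j yvar j ^+ V j) = 'X_[biexp U V].
Proof.
rewrite mpolyXE_id big_split_ord /=; congr (_ * _); apply: eq_bigr => i _.
  by rewrite biexp_lshift.
by rewrite biexp_rshift.
Qed.

Lemma biexpD U V U' V' :
  biexp (fun i => U i + U' i)%N (fun j => V j + V' j)%N
  = (biexp U V + biexp U' V')%MM.
Proof.
by apply/mnmP=> k; rewrite mnmDE !mnmE; case: (split k).
Qed.

Lemma biexp_eq U V U' V' :
  (biexp U V == biexp U' V')
  = [forall i, U i == U' i] && [forall j, V j == V' j].
Proof.
apply/eqP/andP=> [/mnmP E | [/forallP EU /forallP EV]].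
  split; apply/forallP=> i.
    by rewrite -(biexp_lshift U V) E biexp_lshift.
  by rewrite -(biexp_rshift U V) E biexp_rshift.
apply/mnmP=> k; rewrite -[k]splitK; case: (split k) => i /=.
  by rewrite !biexp_lshift (eqP (EU i)).
by rewrite !biexp_rshift (eqP (EV i)).
Qed.

Lemma yvar_inj : injective yvar.
Proof.
move=> i j /(congr1 (mcoeff U_(rshift N i))); rewrite !mcoeffXU eqxx.
by case: eqP => // /rshift_inj.
Qed.

(** All monomials of such a product have degree greater than [b] in x_i. *)
Lemma mcoeff_mul_high (p : R) (i : 'I_N) (q : R) (b : nat) (U V : 'I_N -> nat) :
  (U i <= b)%N -> (p * (xvar i * q) ^+ b.+1)@_(biexp U V) = 0.
Proof.
move=> Ub; rewrite exprMn mulrCA /xvar mpolyXn mcoeffM.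
apply: big1 => -[/= m1 m2] /eqP /mnmP /(_ (lshift N i)).
rewrite biexp_lshift mnmDE => E; apply/eqP; rewrite mulf_eq0; apply/orP; left.
rewrite mcoeffX; have [mE|//] := eqVneq (U_(lshift N i) *+ b.+1)%MM (bmnm m1).
by move: E; rewrite -mE mulmnE mnmE eqxx mul1n; lia.
Qed.

(** Hence truncating the geometric series in each x_i y_j at degree [b] does not
    affect the coefficients of degree at most [b] in every x_i. *)
Lemma mcoeff_mul_prod_high (p : R) (s : seq ('I_N * 'I_N)) (b : nat)
    (U V : 'I_N -> nat) :
  (forall i, U i <= b)%N ->
  (p * \prod_(c <- s) (1 - (xvar c.1 * yvar c.2) ^+ b.+1))@_(biexp U V)
  = p@_(biexp U V).
Proof.
move=> Ub; elim: s p => [|c s IHs] p; first by rewrite big_nil mulr1.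
by rewrite big_cons mulrA IHs mulrBr mulr1 mcoeffB mcoeff_mul_high ?subr0.
Qed.

Definition truncated_geometric (b : nat) (z : R) : R := \sum_(k < b.+1) z ^+ k.

Lemma truncated_geometricM b z :
  (1 - z) * truncated_geometric b z = 1 - z ^+ b.+1.
Proof.
rewrite -[in RHS](expr1n _ b.+1) subrXX; congr (_ * _).
by apply: eq_bigr => k _; rewrite expr1n mul1r.
Qed.

End Alphabets.

Section Margins.

Variables (N b : nat).

Definition row_sum (M : {ffun 'I_N * 'I_N -> 'I_b.+1}) (i : 'I_N) : nat :=
  \sum_j M (i, j).
Definition col_sum (M : {ffun 'I_N * 'I_N -> 'I_b.+1}) (j : 'I_N) : nat :=
  \sum_i M (i, j).

Lemma prod_truncated_geometric :
  \prod_(c : 'I_N * 'I_N) truncated_geometric b (xvar c.1 * yvar c.2)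
  = \sum_(M : {ffun 'I_N * 'I_N -> 'I_b.+1}) 'X_[biexp (row_sum M) (col_sum M)].
Proof.
rewrite bigA_distr_bigA; apply: eq_bigr => M _; rewrite -prod_xyvar.
under eq_bigr => c _ do rewrite exprMn.
rewrite big_split /=; congr (_ * _).
  by rewrite big_pairs; apply: eq_bigr => i _ /=; rewrite -expr_sum.
rewrite big_pairs exchange_big.
by apply: eq_bigr => j _ /=; rewrite -expr_sum.
Qed.

(** Both sides are the coefficient of x^U y^V in the product of the two alternants
    and of the series 1 / (1 - x_i y_j), truncated.  Expanding the alternants and
    the series gives the left hand side.  By Cauchy's determinant the product is
    also a signed sum over [p] in which all series cancel but those at the
    positions (i, p i), and these only produce monomials x^k y^(k p^-1). *)
Lemma cauchy_margins_nat (U V : 'I_N -> nat) :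
  (forall i, U i <= b)%N ->
  \sum_(s : 'S_N) \sum_(t : 'S_N) (-1) ^+ s * (-1) ^+ t *
    \sum_(M : {ffun 'I_N * 'I_N -> 'I_b.+1})
      ([forall i, N.-1 - s i + row_sum M i == U i]%N
       && [forall j, N.-1 - t j + col_sum M j == V j]%N)%:R
  = \sum_(p : 'S_N) (-1) ^+ p * [forall i, U i == V (p i)]%:R :> int.
Proof.
move=> Ub; pose H (c : 'I_N * 'I_N) := truncated_geometric b (xvar c.1 * yvar c.2).
pose P := \det (alternant (@xvar N)) * \det (alternant (@yvar N)) * \prod_c H c.
transitivity P@_(biexp U V).
  rewrite /P /determinant prod_truncated_geometric -mulrA mulr_suml.
  rewrite raddf_sum; apply: eq_bigr => s _ /=.
  rewrite mulr_suml mulr_sumr raddf_sum; apply: eq_bigr => t _ /=.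
  rewrite !mulr_sumr raddf_sum; apply: eq_bigr => M _ /=.
  under eq_bigr => i _ do rewrite mxE.
  under [\prod_(i < N) alternant _ _ _]eq_bigr => i _ do rewrite mxE.
  have -> : forall (e1 e2 X Y Z : {mpoly int[N + N]}),
      e1 * X * (e2 * Y * Z) = e1 * e2 * (X * Y * Z) by move=> *; ring.
  rewrite prod_xyvar -mpolyXD -biexpD -biexp_eq -!signr_addb.
  by case: (_ (+) _); rewrite ?expr1 ?expr0 ?mulN1r ?mul1r ?mcoeffN mcoeffX.
rewrite /P -cauchy_determinant; last exact: yvar_inj.
rewrite /determinant mulr_suml raddf_sum; apply: eq_bigr => p _ /=.
under eq_bigr => i _ do rewrite mxE.
have -> : \prod_c H c = (\prod_i H (i, p i)) * \prod_i \prod_(l | l != p i) H (i, l).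
  rewrite -big_split big_pairs; apply: eq_bigr => i _.
  by rewrite (bigD1 (p i)).
have -> : forall e A X Y : {mpoly int[N + N]},
    e * A * (X * Y) = e * X * (A * Y) by move=> *; ring.
rewrite -big_split /=.
under [\prod_(i < N) (_ * _)]eq_bigr => i _ do rewrite -big_split /=.
have -> : \prod_i \prod_(l | l != p i) ((1 - xvar i * yvar l) * H (i, l))
  = \prod_(c <- [seq c <- index_enum _ | c.2 != p c.1])
       (1 - (xvar c.1 * yvar c.2) ^+ b.+1).
  rewrite big_filter.
  rewrite [RHS]big_mkcond [RHS]big_pairs; apply: eq_bigr => i _.
  rewrite [LHS]big_mkcond; apply: eq_bigr => l _ /=.
  by rewrite truncated_geometricM.
rewrite mcoeff_mul_prod_high //.
have -> : \prod_i H (i, p i)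
    = \sum_(k : {ffun 'I_N -> 'I_b.+1})
        'X_[biexp (fun i => k i) (fun j => k ((p^-1)%g j))].
  rewrite bigA_distr_bigA; apply: eq_bigr => k _; rewrite -prod_xyvar.
  rewrite [X in _ * X](reindex_inj (@perm_inj _ p)) -big_split /=.
  by apply: eq_bigr => i _; rewrite permK exprMn.
have -> : forall z : {mpoly int[N + N]},
    ((-1) ^+ p * z)@_(biexp U V) = (-1) ^+ p * z@_(biexp U V).
  by move=> z; case: (odd_perm p); rewrite ?expr1 ?expr0 ?mulN1r ?mul1r ?mcoeffN.
congr (_ * _); rewrite raddf_sum /=.
under eq_bigr => k _ do rewrite mcoeffX biexp_eq.
have [/forallP UV | nUV] := boolP [forall i, U i == V (p i)].
  (* The only exponents that contribute are those of [U] itself. *)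
  rewrite (bigD1 [ffun i => inord (U i)]) //= big1 ?addr0 => [|k kU].
    congr (_%:R); apply/eqP; rewrite eqb1; apply/andP; split; apply/forallP=> i.
      by rewrite ffunE inordK // ltnS.
    by rewrite ffunE inordK ?ltnS // (eqP (UV _)) permKV.
  apply/eqP; rewrite pnatr_eq0 eqb0 negb_and; apply/orP; left.
  apply: contra kU => /forallP kU; apply/eqP/ffunP=> i.
  by rewrite ffunE -(eqP (kU i)) inord_val.
rewrite big1 // => k _; apply/eqP; rewrite pnatr_eq0 eqb0.
apply: contra nUV => /andP[/forallP kU /forallP kV]; apply/forallP=> i.
by rewrite -(eqP (kU i)) -(eqP (kV (p i))) permK.
Qed.

End Margins.

(** The composition indexing the term of the permutation [s] in the
    Jacobi-Trudi expansion along [u]. *)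
Definition jt_index (N : nat) (u : 'I_N -> int) (s : 'S_N) (i : 'I_N) : int :=
  u i + (s i)%:Z - i%:Z.

(** The permutation [p] carries u + delta, with delta_i = N - 1 - i, to v + delta;
    a negative entry would not be the exponent of a monomial. *)
Definition straightens (N : nat) (u v : 'I_N -> int) (p : 'S_N) : bool :=
  [forall i, u i - i%:Z == v (p i) - (p i)%:Z]
  && [forall i : 'I_N, 0 <= u i + (N.-1 - i)%N%:Z].

(** Integer form of the previous count, stated along Jacobi-Trudi indices.  When
    an entry of [u + delta] or [v + delta] is negative both sides vanish: each
    index along that vector has a negative entry, which no margin can match. *)
Lemma cauchy_margins (N b : nat) (u v : 'I_N -> int) :
  (forall i : 'I_N, u i + (N.-1 - i)%N%:Z <= b%:Z) ->
  \sum_(s : 'S_N) \sum_(t : 'S_N) (-1) ^+ s * (-1) ^+ t *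
    \sum_(M : {ffun 'I_N * 'I_N -> 'I_b.+1})
      ([forall i, (row_sum M i)%:Z == jt_index u s i]
       && [forall j, (col_sum M j)%:Z == jt_index v t j])%:R
  = \sum_(p : 'S_N) (-1) ^+ p * (straightens u v p)%:R :> int.
Proof.
move=> ub.
have ltN (i : 'I_N) : (i <= N.-1)%N by have := ltn_ord i; lia.
have [/andP[/forallP u0 /forallP v0] | neg] :=
    boolP ([forall i : 'I_N, 0 <= u i + (N.-1 - i)%N%:Z]
           && [forall i : 'I_N, 0 <= v i + (N.-1 - i)%N%:Z]).
  pose U i := absz (u i + (N.-1 - i)%N%:Z); pose V i := absz (v i + (N.-1 - i)%N%:Z).
  have UE i : (U i)%:Z = u i + (N.-1 - i)%N%:Z by rewrite /U gez0_abs.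
  have VE i : (V i)%:Z = v i + (N.-1 - i)%N%:Z by rewrite /V gez0_abs.
  have Ub i : (U i <= b)%N by rewrite -lez_nat UE.
  transitivity (\sum_(p : 'S_N) (-1) ^+ p * [forall i, U i == V (p i)]%:R : int).
    rewrite -(cauchy_margins_nat V Ub).
    apply: eq_bigr => s _; apply: eq_bigr => t _; congr (_ * _).
    apply: eq_bigr => M _; congr (nat_of_bool (_ && _))%:R; apply: eq_forallb => i.
      rewrite -[in RHS]eqz_nat PoszD UE /jt_index.
      have ? := ltN i; have ? := ltN (s i); apply/eqP/eqP; lia.
    rewrite -[in RHS]eqz_nat PoszD VE /jt_index.
    have ? := ltN i; have ? := ltN (t i); apply/eqP/eqP; lia.
  apply: eq_bigr => p _; congr (_ * (nat_of_bool _)%:R).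
  have -> : straightens u v p = [forall i, u i - i%:Z == v (p i) - (p i)%:Z].
    by rewrite /straightens (introT forallP u0) andbT.
  apply: eq_forallb => i; rewrite -eqz_nat UE VE.
  have ? := ltN i; have ? := ltN (p i); apply/eqP/eqP; lia.
rewrite big1 => [|s _]; last first.
  apply: big1 => t _; rewrite big1 ?mulr0 // => M _; apply/eqP.
  rewrite pnatr_eq0 eqb0; apply: contra neg => /andP[/forallP r /forallP c].
  apply/andP; split; apply/forallP=> i.
    have /eqP := r i; rewrite /jt_index; have := ltN i; have := ltN (s i); lia.
  have /eqP := c i; rewrite /jt_index; have := ltN i; have := ltN (t i); lia.
rewrite big1 // => p _; case: (boolP (straightens u v p)) => [|_]; last exact: mulr0.
case/andP=> /forallP uv u0; case/negP: neg; rewrite u0; apply/forallP=> j.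
have /eqP := uv ((p^-1)%g j); have := forallP u0 ((p^-1)%g j); rewrite permKV.
have := ltN j; have := ltN ((p^-1)%g j); lia.
Qed.

(** * Counting words fixed by permutations *)

Section Words.

Variables (n : nat) (I : finType).
Implicit Types (f g : {ffun 'I_n -> I}) (w : 'S_n).

Definition content f (i : I) : nat := \sum_x (f x == i).

Definition fixed_by w f : bool := [forall x, f (w x) == f x].

Definition word_act f w : {ffun 'I_n -> I} := [ffun x => f ((w^-1)%g x)].

Lemma word_act1 : word_act^~ 1%g =1 id.
Proof. by move=> f; apply/ffunP=> x; rewrite ffunE invg1 perm1. Qed.

Lemma word_actM f : act_morph word_act f.
Proof. by move=> w1 w2; apply/ffunP=> x; rewrite !ffunE invMg permM. Qed.

Definition word_action := TotalAction word_act1 word_actM.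

Lemma fixed_byE w f : fixed_by w f = (word_act f w == f).
Proof.
apply/forallP/eqP=> [fw | fw x].
  by apply/ffunP=> x; rewrite ffunE -(eqP (fw _)) permKV.
by rewrite -{1}fw ffunE permK.
Qed.

Lemma content_act f w i : content (word_act f w) i = content f i.
Proof.
rewrite /content (reindex_inj (@perm_inj _ w)) /=.
by apply: eq_bigr => x _; rewrite ffunE permK.
Qed.

Lemma sum_content f : \sum_i content f i = n.
Proof.
rewrite exchange_big /= -[RHS]card_ord -sum1_card; apply: eq_bigr => x _.
by rewrite (bigD1 (f x)) //= eqxx big1 // => i /negbTE; rewrite eq_sym => ->.
Qed.

Lemma content_le f i : (content f i <= n)%N.
Proof. by rewrite -[leqRHS](sum_content f) (bigD1 i) //= leq_addr. Qed.

Lemma content_orbit f g : content f =1 content g -> exists w, g = word_act f w.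
Proof.
move=> fg; have : perm_eq [tuple g x | x < n] [tuple f x | x < n].
  apply/allP=> i _ /=; have countE (h : {ffun 'I_n -> I}) :
      count_mem i [tuple h x | x < n] = content h i.
    rewrite /content -sum1_count big_mkcond big_tuple.
    by apply: eq_bigr => x _; rewrite tnth_mktuple /=; case: eqP.
  by rewrite !countE fg.
case/tuple_permP=> w /val_inj gw; exists (w^-1)%g; apply/ffunP=> x.
have := congr1 (fun t => tnth t x) gw.
by rewrite !tnth_mktuple ffunE invgK.
Qed.

Lemma content_surj (m : I -> nat) : \sum_i m i = n -> exists f, content f =1 m.
Proof.
move=> mn; pose s := flatten [seq nseq (m i) i | i <- enum I].
have szs : size s == n.
  rewrite size_flatten /shape -map_comp sumnE big_map big_enum -[X in _ == X]mn /=.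
  by apply/eqP/eq_bigr => i _; rewrite size_nseq.
exists [ffun x => tnth (Tuple szs) x] => i.
transitivity (count_mem i s).
  rewrite -sum1_count -[s]/(tval (Tuple szs)) big_mkcond big_tuple.
  by apply: eq_bigr => x _; rewrite ffunE /=; case: eqP.
rewrite /s count_flatten -map_comp sumnE big_map big_enum (bigD1 i) //=.
rewrite count_nseq /= eqxx mul1n big1 ?addn0 // => j /negbTE ji.
by rewrite count_nseq /= ji mul0n.
Qed.

(** Burnside's lemma on the words of a given content, which form one orbit if the
    content has total [n], and none otherwise. *)
Lemma sum_stabilizers (P : pred {ffun 'I_n -> I}) (m : I -> nat) :
  (forall f, P f <-> content f =1 m) ->
  \sum_(w : 'S_n) #|[set f | P f & fixed_by w f]|
  = ((\sum_i m i == n)%N * n`!)%N.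
Proof.
move=> Pm; pose S := [set f | P f].
have actS : [acts [set: 'S_n], on S | word_action].
  apply/actsP=> w _ f; rewrite !inE.
  by apply/idP/idP => /Pm fm; apply/Pm=> i; rewrite -fm content_act.
have fixE (w : 'S_n) :
    [set f | P f & fixed_by w f] = 'Fix_(S | word_action)[w]%g.
  by apply/setP=> f; rewrite !inE sub1set !inE fixed_byE.
transitivity (\sum_(w : 'S_n) #|'Fix_(S | word_action)[w]%g|)%N.
  by apply: eq_bigr => w _; rewrite -fixE.
have := Frobenius_Cauchy actS; under eq_bigl => w do rewrite inE.
rewrite cardsT card_Sn => ->; congr (_ * _)%N.
have [mn | mn] := eqVneq (\sum_i m i)%N n.
  have [f0 f0m] := content_surj mn.
  apply/eqP/cards1P; exists (orbit word_action [set: 'S_n] f0).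
  apply/setP=> O; rewrite inE; apply/imsetP/eqP=> [[f fS ->] | ->].
    apply/orbit_eqP/orbitP.
    have [w ->] : exists w, f = word_act f0 w.
      by apply: content_orbit => i; rewrite f0m; move: fS; rewrite inE => /Pm ->.
    by exists w; rewrite ?inE.
  by exists f0; rewrite // inE; apply/Pm.
apply/eqP; rewrite /= cards_eq0 -subset0; apply/subsetP=> O /imsetP[f fS _].
move: fS; rewrite inE => /Pm fm; case/eqP: mn.
by rewrite -[RHS](sum_content f); apply: eq_bigr => i _; rewrite fm.
Qed.

End Words.

(** Summing the previous lemma over all contents. This trades products of
    permutation characters, averaged over the group, for counts of arrays. *)
Lemma sum_fixed_words (n b : nat) (I : finType) (Q : (I -> nat) -> bool) :
  (n <= b)%N -> (forall m1 m2, m1 =1 m2 -> Q m1 = Q m2) ->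
  (\sum_(w : 'S_n) \sum_(f : {ffun 'I_n -> I} | fixed_by w f) Q (content f)
  = n`! * \sum_(m : {ffun I -> 'I_b.+1} | \sum_i m i == n) Q (fun i => m i))%N.
Proof.
move=> nb Qext; pose cont (f : {ffun 'I_n -> I}) : {ffun I -> 'I_b.+1} :=
  [ffun i => inord (content f i)].
have contE f (m : {ffun I -> 'I_b.+1}) : (cont f == m) <-> (content f =1 fun i => m i).
  split=> [/eqP <- i | fm]; last by apply/eqP/ffunP=> i; rewrite ffunE fm inord_val.
  by rewrite ffunE inordK // ltnS (leq_trans (content_le f i)).
transitivity (\sum_(w : 'S_n) \sum_(m : {ffun I -> 'I_b.+1})
    Q (fun i => m i) * #|[set f | cont f == m & fixed_by w f]|)%N.
  apply: eq_bigr => w _; rewrite (partition_big cont xpredT) //=.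
  apply: eq_bigr => m _; rewrite -sum1_card big_distrr /=.
  apply: eq_big => f; first by rewrite inE andbC.
  by case/andP=> _ /contE fm; rewrite muln1 (Qext _ _ fm).
rewrite exchange_big /= big_distrr [RHS]big_mkcond /=; apply: eq_bigr => m _.
rewrite -big_distrr /= (sum_stabilizers (m := fun i => m i)) => [|f]; last exact: contE.
by case: eqP; rewrite ?mul1n ?mul0n ?muln0 // mulnC.
Qed.

Definition has_content (n N : nat) (a : 'I_N -> int) (f : {ffun 'I_n -> 'I_N}) :=
  [forall j, (content f j)%:Z == a j].

(** The value at [w] of the permutation character phi^a; it is 0 if [a] has a
    negative entry or does not have total [n]. *)
Definition num_fixed (n N : nat) (a : 'I_N -> int) (w : 'S_n) : nat :=
  \sum_(f : {ffun 'I_n -> 'I_N} | fixed_by w f) has_content a f.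

Definition jt_value (n N : nat) (u : 'I_N -> int) (w : 'S_n) : int :=
  \sum_(s : 'S_N) (-1) ^+ s * (num_fixed (jt_index u s) w)%:R.

Lemma sum_jt_index (N : nat) (u : 'I_N -> int) (s : 'S_N) :
  \sum_i jt_index u s i = \sum_i u i.
Proof.
rewrite sumrB big_split /= [X in _ - X](reindex_inj (@perm_inj _ s)) /=.
exact: addrK.
Qed.

Lemma sum_fixed_pairs (n : nat) (I J : finType) (w : 'S_n)
    (F : {ffun 'I_n -> I} -> {ffun 'I_n -> J} -> nat) :
  (\sum_(f | fixed_by w f) \sum_(g | fixed_by w g) F f g
  = \sum_(h : {ffun 'I_n -> I * J} | fixed_by w h)
      F [ffun x => (h x).1] [ffun x => (h x).2])%N.
Proof.
rewrite pair_big /=.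
pose join (fg : {ffun 'I_n -> I} * {ffun 'I_n -> J}) :=
  [ffun x => (fg.1 x, fg.2 x)] : {ffun 'I_n -> I * J}.
pose cut (h : {ffun 'I_n -> I * J}) := ([ffun x => (h x).1], [ffun x => (h x).2])
  : {ffun 'I_n -> I} * {ffun 'I_n -> J}.
have joinK : cancel join cut.
  by case=> f g; congr pair; apply/ffunP=> x; rewrite !ffunE.
have cutK : cancel cut join.
  by move=> h; apply/ffunP=> x; rewrite !ffunE; case: (h x).
rewrite (reindex cut) /=; last by exists join => ? _.
apply: eq_bigl => h; apply/andP/forallP=> [[/forallP f /forallP g] x | h'].
  by have := f x; have := g x; rewrite !ffunE -[h (w x) == _]/(_ && _) => -> ->.
by split; apply/forallP=> x; rewrite !ffunE (eqP (h' x)).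
Qed.

Lemma content_fst (n : nat) (I J : finType) (h : {ffun 'I_n -> I * J}) i :
  content [ffun x => (h x).1] i = (\sum_j content h (i, j))%N.
Proof.
rewrite /content exchange_big; apply: eq_bigr => x _; rewrite ffunE.
case: (h x) => i' j' /=; rewrite (bigD1 j') //= xpair_eqE eqxx andbT.
by rewrite big1 ?addn0 // => j /negbTE; rewrite xpair_eqE eq_sym andbC => ->.
Qed.

Lemma content_snd (n : nat) (I J : finType) (h : {ffun 'I_n -> I * J}) j :
  content [ffun x => (h x).2] j = (\sum_i content h (i, j))%N.
Proof.
rewrite /content exchange_big; apply: eq_bigr => x _; rewrite ffunE.
case: (h x) => i' j' /=; rewrite (bigD1 i') //= xpair_eqE eqxx.
by rewrite big1 ?addn0 // => i /negbTE; rewrite xpair_eqE eq_sym => ->.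
Qed.

(** * Three-dimensional arrays *)

Section Arrays.

Variable N : nat.

Definition rows r (m : 'I_N * 'I_N * 'I_r -> nat) i : nat :=
  \sum_j \sum_k m (i, j, k).
Definition cols r (m : 'I_N * 'I_N * 'I_r -> nat) j : nat :=
  \sum_i \sum_k m (i, j, k).
Definition slices r (m : 'I_N * 'I_N * 'I_r -> nat) k : nat :=
  \sum_i \sum_j m (i, j, k).

Definition has_margins r (a b : 'I_N -> int) (c : 'I_r -> int) m : bool :=
  [&& [forall i, (rows m i)%:Z == a i], [forall j, (cols m j)%:Z == b j]
    & [forall k, (slices m k)%:Z == c k]].

(** A triple of words is one word in the triples of letters, whose content is a
    three-dimensional array; the contents of the three words are its margins. *)
Lemma sum_num_fixed3 (n B r : nat) (a b : 'I_N -> int) (c : 'I_r -> int) :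
  (n <= B)%N ->
  (\sum_(w : 'S_n) num_fixed a w * num_fixed b w * num_fixed c w
  = n`! * \sum_(m : {ffun 'I_N * 'I_N * 'I_r -> 'I_B.+1} | \sum_c m c == n)
            has_margins a b c (fun c => m c))%N.
Proof.
move=> nB; rewrite -sum_fixed_words //; last first.
  move=> m1 m2 m12; rewrite /has_margins /rows /cols /slices.
  by congr [&& _, _ & _]; apply: eq_forallb => i; do 2 f_equal;
    apply: eq_bigr => j _; apply: eq_bigr => k _; rewrite m12.
apply: eq_bigr => w _.
transitivity (\sum_(f : {ffun 'I_n -> 'I_N} | fixed_by w f)
   \sum_(g : {ffun 'I_n -> 'I_N} | fixed_by w g)
   \sum_(h : {ffun 'I_n -> 'I_r} | fixed_by w h)
     has_content a f * has_content b g * has_content c h)%N.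
  rewrite /num_fixed big_distrlr big_distrl /=; apply: eq_bigr => f _.
  by rewrite big_distrl /=; apply: eq_bigr => g _; rewrite big_distrr.
rewrite sum_fixed_pairs sum_fixed_pairs; apply: eq_bigr => h _.
rewrite !mulnb; congr (nat_of_bool _); rewrite /has_margins andbA.
congr (_ && _ && _); apply: eq_forallb => i; do 2 f_equal.
- rewrite content_fst; apply: eq_bigr => j _; rewrite -content_fst.
  by congr (content _ _); apply/ffunP=> x; rewrite !ffunE.
- rewrite content_snd; apply: eq_bigr => j _; rewrite -content_fst.
  by congr (content _ _); apply/ffunP=> x; rewrite !ffunE.
- by rewrite content_snd big_pairs.
Qed.

End Arrays.

Section FirstSlice.

Variables (N r B : nat).
Local Notation matrix2 := {ffun 'I_N * 'I_N -> 'I_B.+1}.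
Local Notation array3 r := {ffun 'I_N * 'I_N * 'I_r -> 'I_B.+1}.

Definition add_slice (M : matrix2) (T : array3 r) : array3 r.+1 :=
  [ffun c => if unlift ord0 c.2 is Some k then T (c.1, k) else M c.1].

Lemma add_slice0 M T i j : add_slice M T (i, j, ord0) = M (i, j).
Proof. by rewrite ffunE unlift_none. Qed.

Lemma add_slice_lift M T i j k : add_slice M T (i, j, lift ord0 k) = T (i, j, k).
Proof. by rewrite ffunE liftK. Qed.

Lemma sum_add_slice (F : array3 r.+1 -> nat) :
  \sum_m F m = \sum_T \sum_M F (add_slice M T).
Proof.
rewrite exchange_big pair_bigA /=.
pose cut (m : array3 r.+1) : matrix2 * array3 r :=
  ([ffun c => m (c, ord0)], [ffun c => m (c.1, lift ord0 c.2)]).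
rewrite (reindex (fun MT => add_slice MT.1 MT.2)) //=.
exists cut => [[M T]|m] _.
  congr pair; apply/ffunP; [case=> i j | case=> -[i j] k].
    by rewrite ffunE add_slice0.
  by rewrite ffunE add_slice_lift.
apply/ffunP=> -[[i j] k]; case: (unliftP ord0 k) => [k' ->|->].
  by rewrite add_slice_lift ffunE.
by rewrite add_slice0 ffunE.
Qed.

Lemma rows_add_slice M T i :
  rows (fun c => add_slice M T c) i = (row_sum M i + rows (fun c => T c) i)%N.
Proof.
rewrite /rows -big_split; apply: eq_bigr => j _ /=.
rewrite big_ord_recl add_slice0; congr (_ + _)%N.
by apply: eq_bigr => k _; rewrite add_slice_lift.
Qed.

Lemma cols_add_slice M T j :
  cols (fun c => add_slice M T c) j = (col_sum M j + cols (fun c => T c) j)%N.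
Proof.
rewrite /cols -big_split; apply: eq_bigr => i _ /=.
rewrite big_ord_recl add_slice0; congr (_ + _)%N.
by apply: eq_bigr => k _; rewrite add_slice_lift.
Qed.

Lemma slices_add_slice M T k :
  slices (fun c => add_slice M T c) (lift ord0 k) = slices (fun c => T c) k.
Proof.
by apply: eq_bigr => i _; apply: eq_bigr => j _; rewrite add_slice_lift.
Qed.

End FirstSlice.

Lemma sum_rows (N r : nat) (m : 'I_N * 'I_N * 'I_r -> nat) :
  \sum_i rows m i = \sum_c m c.
Proof. by rewrite !big_pairs. Qed.

Lemma sum_cols (N r : nat) (m : 'I_N * 'I_N * 'I_r -> nat) :
  \sum_j cols m j = \sum_c m c.
Proof. by rewrite !big_pairs exchange_big. Qed.

Lemma sum_slices (N r : nat) (m : 'I_N * 'I_N * 'I_r -> nat) :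
  \sum_k slices m k = \sum_c m c.
Proof. by rewrite big_pairs exchange_big; apply: eq_bigr => k _; rewrite big_pairs. Qed.

(** Once the row sums are prescribed the total is, so the sum of the first
    slice is determined by those of the others. *)
Lemma has_margins_add_slice (n N r B : nat) (a b : 'I_N -> int)
    (c : 'I_r.+1 -> int) (M : {ffun 'I_N * 'I_N -> 'I_B.+1})
    (T : {ffun 'I_N * 'I_N * 'I_r -> 'I_B.+1}) :
  \sum_i a i = n%:Z -> \sum_k c k = n%:Z ->
  (\sum_x add_slice M T x == n)%N
     && has_margins a b c (fun x => add_slice M T x)
  = [forall k, (slices (fun x => T x) k)%:Z == c (lift ord0 k)]
    && ([forall i, (row_sum M i)%:Z == a i - (rows (fun x => T x) i)%:Z]
        && [forall j, (col_sum M j)%:Z == b j - (cols (fun x => T x) j)%:Z]).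
Proof.
move=> an cn; rewrite /has_margins.
have -> : [forall i, (rows (fun x => add_slice M T x) i)%:Z == a i]
    = [forall i, (row_sum M i)%:Z == a i - (rows (fun x => T x) i)%:Z].
  by apply: eq_forallb => i; rewrite rows_add_slice PoszD; apply/eqP/eqP; lia.
have -> : [forall i, (cols (fun x => add_slice M T x) i)%:Z == b i]
    = [forall i, (col_sum M i)%:Z == b i - (cols (fun x => T x) i)%:Z].
  by apply: eq_forallb => i; rewrite cols_add_slice PoszD; apply/eqP/eqP; lia.
have [/forallP Ma|_] := boolP
  [forall i, (row_sum M i)%:Z == a i - (rows (fun x => T x) i)%:Z]; last by rewrite !andbF.
have tot : (\sum_x add_slice M T x)%N = n.
  rewrite -sum_rows; apply/eqP; rewrite -eqz_nat -an; apply/eqP.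
  rewrite (raddf_sum Posz).
  by apply: eq_bigr => i _; rewrite /= rows_add_slice PoszD (eqP (Ma i)) subrK.
rewrite tot eqxx /= andbC; congr (_ && _).
apply/forallP/forallP=> [Tc k|Tc]; first by rewrite -(slices_add_slice M).
have lifted k : slices (fun x => add_slice M T x) (lift ord0 k) = c (lift ord0 k) :> int.
  by rewrite slices_add_slice (eqP (Tc k)).
move=> k; case: (unliftP ord0 k) => [k' ->|->]; first by rewrite lifted.
move: cn; rewrite -tot -sum_slices (raddf_sum Posz) !big_ord_recl /=.
by rewrite (eq_bigr _ (fun k _ => lifted k)) => /addIr ->.
Qed.

(** Only the first slice depends on the permutations [s1] and [s2] of the first two
    factors once the array [T] of the other slices is fixed, and the sum over
    [s1], [s2] and the first slice is an instance of [cauchy_margins]. *)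
Lemma sum_jt_values3 (n B N r : nat) (u v : 'I_N -> int) (t : 'I_r.+1 -> int) :
  (n <= B)%N -> (forall i : 'I_N, u i + (N.-1 - i)%N%:Z <= B%:Z) ->
  \sum_i u i = n%:Z -> \sum_k t k = n%:Z ->
  \sum_(w : 'S_n) jt_value u w * jt_value v w * jt_value t w
  = n`!%:R * \sum_(q : 'S_r.+1) (-1) ^+ q *
      \sum_(T : {ffun 'I_N * 'I_N * 'I_r -> 'I_B.+1} |
          [forall k, (slices (fun c => T c) k)%:Z == jt_index t q (lift ord0 k)])
        \sum_(p : 'S_N) (-1) ^+ p *
          (straightens (fun i => u i - (rows (fun c => T c) i)%:Z)
                       (fun j => v j - (cols (fun c => T c) j)%:Z) p)%:R.
Proof.
move=> nB ub un tn.
transitivity (\sum_(q : 'S_r.+1) (-1) ^+ q * \sum_(s1 : 'S_N) \sum_(s2 : 'S_N)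
    (-1) ^+ s1 * (-1) ^+ s2 *
    (\sum_(w : 'S_n) num_fixed (jt_index u s1) w * num_fixed (jt_index v s2) w
                   * num_fixed (jt_index t q) w)%N%:R : int).
  rewrite /jt_value; under eq_bigr => w _ do rewrite mulr_sumr.
  rewrite exchange_big; apply: eq_bigr => q _.
  under eq_bigr => w _ do rewrite mulr_suml mulr_suml.
  rewrite exchange_big mulr_sumr; apply: eq_bigr => s1 _.
  under eq_bigr => w _ do rewrite mulr_sumr mulr_suml.
  rewrite exchange_big mulr_sumr; apply: eq_bigr => s2 _.
  rewrite natr_sum mulrA mulr_sumr; apply: eq_bigr => w _.
  rewrite !natrM; move: (_ ^+ s1) (_ ^+ s2) (_ ^+ q) => e1 e2 e3.
  move: (_%:R) (_%:R) (_%:R) => x1 x2 x3; ring.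
rewrite mulr_sumr; apply: eq_bigr => q _; rewrite [RHS]mulrCA; congr (_ * _).
under [X in _ = _ * X]eq_bigr => T _.
  rewrite -(@cauchy_margins N B); last first.
    by move=> i; apply: le_trans (ub i); lia.
  over.
rewrite [X in _ = _ * X]exchange_big mulr_sumr; apply: eq_bigr => s1 _ /=.
rewrite [X in _ = _ * X]exchange_big mulr_sumr; apply: eq_bigr => s2 _ /=.
rewrite -mulr_sumr [RHS]mulrCA (sum_num_fixed3 _ _ _ nB) natrM; congr (_ * (_ * _)).
rewrite big_mkcond sum_add_slice natr_sum [RHS]big_mkcond /=.
apply: eq_bigr => T _; rewrite natr_sum.
have marg M := has_margins_add_slice (jt_index v s2) M T
  (etrans (sum_jt_index u s1) un) (etrans (sum_jt_index t q) tn).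
under eq_bigr => M _.
  rewrite (_ : (if _ then _ else _) = ((\sum_x add_slice M T x == n)%N
     && has_margins (jt_index u s1) (jt_index v s2) (jt_index t q)
          (fun x => add_slice M T x) : nat)); last by case: (_ == n).
  rewrite marg.
  over.
case: ifP => _ /=; last by rewrite big1.
apply: eq_bigr => M _; congr (nat_of_bool (_ && _))%:R; apply: eq_forallb => i.
  by congr (_ == _); rewrite /jt_index; lia.
by congr (_ == _); rewrite /jt_index; lia.
Qed.

(** * The characters of the symmetric group *)

Lemma fixed_byJ (n : nat) (I : finType) (w g : 'S_n) (f : {ffun 'I_n -> I}) :
  fixed_by (w ^ g)%g (word_act f g) = fixed_by w f.
Proof.
apply/forallP/forallP=> fw x.
  by have := fw (g x); rewrite !ffunE conjgE !permM !permK.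
by rewrite !ffunE conjgE !permM permK; apply: fw.
Qed.

Lemma num_fixedJ (n N : nat) (a : 'I_N -> int) (w g : 'S_n) :
  num_fixed a (w ^ g)%g = num_fixed a w.
Proof.
rewrite /num_fixed (reindex_inj (act_inj (word_action n _) g)) /=.
apply: eq_big => f; first by rewrite fixed_byJ.
by move=> _; congr nat_of_bool; apply: eq_forallb => j; rewrite content_act.
Qed.

Fact perm_cf_subproof (n N : nat) (a : 'I_N -> int) :
  is_class_fun <<[set: 'S_n]>>%g [ffun w => (num_fixed a w)%:R : algC].
Proof.
rewrite genGid; apply: intro_class_fun => [w g _ _ | w]; first by rewrite num_fixedJ.
by rewrite inE.
Qed.

(** The permutation character on the words of content [a]. *)
Definition perm_cf (n N : nat) (a : 'I_N -> int) : 'CF([set: 'S_n]) :=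
  Cfun 0 (perm_cf_subproof n a).

Lemma perm_cfE (n N : nat) (a : 'I_N -> int) (w : 'S_n) :
  perm_cf n a w = (num_fixed a w)%:R.
Proof. by rewrite cfunElock. Qed.

Definition jt_cf (n N : nat) (u : 'I_N -> int) : 'CF([set: 'S_n]) :=
  \sum_(s : 'S_N) (-1) ^+ s *: perm_cf n (jt_index u s).

Lemma jt_cfE (n N : nat) (u : 'I_N -> int) (w : 'S_n) :
  jt_cf n u w = (jt_value u w)%:~R.
Proof.
rewrite sum_cfunE /jt_value raddf_sum /=; apply: eq_bigr => s _.
by rewrite cfunE perm_cfE rmorphM rmorphXn rmorphN rmorph1 rmorph_nat.
Qed.

(** * Young subgroups *)

Lemma sum_blocks (N : nat) (a : seq nat) (F : nat -> nat -> nat) :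
  (size a <= N)%N ->
  (\sum_(x < sumn a) F (reshape_index a x) (reshape_offset a x)
  = \sum_(j < N) \sum_(c < nth 0 a j) F j c)%N.
Proof.
elim: a N F => [|m a IHa] [|N] F //= leN.
- by rewrite !big_ord0.
- by rewrite big_ord0 big1 // => j _; rewrite nth_nil big_ord0.
rewrite big_split_ord big_ord_recl /=; congr (_ + _)%N.
  apply: eq_bigr => x _; have xm := ltn_ord x.
  have i0 : reshape_index (m :: a) x = 0%N.
    by rewrite /reshape_index /= (_ : (x.+1 - m == 0)%N) // subn_eq0.
  by rewrite /reshape_offset i0 take0 subn0.
rewrite -(IHa N (fun j => F j.+1)) //; apply: eq_bigr => x _ /=.
have i1 : reshape_index (m :: a) (m + x) = (reshape_index a x).+1.
  rewrite /reshape_index /= -addnS addKn.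
  by case: eqP => // /eqP; rewrite -subn_eq0 addKn.
by rewrite i1 /reshape_offset i1 /= subnDl.
Qed.

Section BlockWord.

Variables (n N : nat) (a : seq nat).
Hypotheses (szN : (size a <= N)%N) (sumn_a : sumn a = n).

Lemma block_lt (x : 'I_n) : (reshape_index a x < N)%N.
Proof. by apply: leq_trans szN; apply: reshape_indexP; rewrite sumn_a. Qed.

Definition block_word : {ffun 'I_n -> 'I_N} := [ffun x => Ordinal (block_lt x)].

Lemma content_block_word j : content block_word j = nth 0%N a j.
Proof.
transitivity (\sum_(x < sumn a) (reshape_index a x == j))%N.
  by rewrite sumn_a; apply: eq_bigr => x _; rewrite ffunE.
rewrite (sum_blocks (fun k _ => (k == j) : nat) szN) (bigD1 j) //= eqxx.
rewrite sum1_card card_ord big1 ?addn0 // => k /negbTE kj.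
by rewrite big1 // => c _; rewrite -[(k == j :> nat)]/(k == j) kj.
Qed.

Lemma fixed_block_word w : fixed_by w block_word = (w \in young_group n a).
Proof.
by rewrite inE; apply: eq_forallb => x; rewrite !ffunE.
Qed.

(** The words of content [a] are the rearrangements of [block_word], and the Young
    subgroup is its stabilizer. *)
Lemma Ind_young_perm_cf :
  'Ind[[set: 'S_n]] (1 : 'CF(young_group n a))
  = perm_cf n (fun j : 'I_N => (nth 0%N a j)%:Z).
Proof.
apply/cfunP=> w; rewrite cfIndE ?subsetT // perm_cfE.
rewrite (reindex_inj invg_inj) /=.
rewrite (_ : \sum_(y | _) _
    = (\sum_(y : 'S_n) fixed_by w (word_act block_word y))%N%:R); last first.
  rewrite natr_sum; apply: eq_big => [y|y _]; first by rewrite inE.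
  rewrite cfun1E -fixed_block_word -(fixed_byJ (w ^ y^-1)%g y) conjgKV.
  by [].
have cardH (f : {ffun 'I_n -> 'I_N}) :
    #|[set y | word_act block_word y == f]|
    = (has_content (fun j : 'I_N => (nth 0%N a j)%:Z) f * #|young_group n a|)%N.
  have [/forallP fa|nfa] := boolP (has_content _ f); last first.
    rewrite mul0n; apply/eqP; rewrite cards_eq0 -subset0; apply/subsetP=> y.
    rewrite inE => /eqP fy; case/negP: nfa; apply/forallP=> j.
    by rewrite -fy content_act content_block_word.
  have [y0 ->] : exists y0, f = word_act block_word y0.
    apply: content_orbit => j; apply/eqP.
    by rewrite content_block_word -eqz_nat eq_sym.
  rewrite mul1n -(card_rcoset (young_group n a) y0); apply: eq_card => y.
  rewrite inE mem_rcoset -fixed_block_word fixed_byE word_actM.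
  apply/eqP/eqP=> [-> | yy0]; first by rewrite -word_actM mulgV word_act1.
  by rewrite -[in RHS]yy0 -[RHS]word_actM mulVg word_act1.
suff -> : (\sum_(y : 'S_n) fixed_by w (word_act block_word y)
    = num_fixed (fun j : 'I_N => (nth 0%N a j)%:Z) w * #|young_group n a|)%N.
  by rewrite natrM mulrC mulfK // pnatr_eq0 -lt0n cardG_gt0.
rewrite (partition_big (word_act block_word) (fun _ => true)) //= big_distrl /=.
rewrite [RHS]big_mkcond; apply: eq_bigr => f _.
transitivity (\sum_(y | word_act block_word y == f) fixed_by w f)%N.
  by apply: eq_bigr => y /eqP ->.
rewrite sum_nat_const -cardsE cardH.
by case: (fixed_by w f); rewrite ?muln1 ?muln0.
Qed.

End BlockWord.

(** Either no word has content [a], or [a] is a composition of [n] and the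
    character is induced from its Young subgroup. *)
Lemma perm_cf_char (n N : nat) (a : 'I_N -> int) : perm_cf n a \is a character.
Proof.
have [f0 /forallP f0a | no] := pickP (has_content a : pred {ffun 'I_n -> 'I_N}).
  pose s := [seq content f0 j | j <- enum 'I_N].
  have szs : size s = N by rewrite size_map size_enum_ord.
  have sums : sumn s = n.
    by rewrite sumnE big_map big_enum -[RHS](sum_content f0).
  have -> : perm_cf n a = 'Ind (1 : 'CF(young_group n s)).
    rewrite (@Ind_young_perm_cf n N) ?szs //; apply/cfunP=> w; rewrite !perm_cfE.
    congr (_%:R); apply: eq_bigr => f _; congr nat_of_bool.
    apply: eq_forallb => j; rewrite (nth_map j) ?size_enum_ord // nth_ord_enum.
    by rewrite (eqP (f0a j)).
  exact/cfInd_char/cfun1_char.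
rewrite (_ : perm_cf n a = 0) ?rpred0 //; apply/cfunP=> w; rewrite perm_cfE cfunE.
by rewrite /num_fixed big1 // => f _; rewrite no.
Qed.

(** * The sign character of a Young subgroup *)

Definition block_injective (n N : nat) (c : seq nat) (f : {ffun 'I_n -> 'I_N}) :=
  [forall x : 'I_n, forall y : 'I_n,
     (reshape_index c x == reshape_index c y) && (f x == f y) ==> (x == y)].

(** If two positions of the same block carry the same letter, exchanging them
    preserves the word and the blocks and pairs off opposite signs.  Otherwise
    only the identity preserves both. *)
Lemma sum_sign_fixing (n N : nat) (c : seq nat) (f : {ffun 'I_n -> 'I_N}) :
  \sum_(w in young_group n c | fixed_by w f) (-1) ^+ (w : 'S_n)
  = (block_injective c f)%:R :> algC.
Proof.
have [inj | ninj] := boolP (block_injective c f).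
  rewrite (big_pred1 (1%g : 'S_n)) ?odd_perm1 // => w.
  apply/andP/eqP=> [[wH wf] | ->]; last first.
    by split; rewrite ?group1 //; apply/forallP=> x; rewrite perm1.
  apply/permP=> x; rewrite perm1; apply/eqP.
  move: wH; rewrite inE => /forallP /(_ x) wH.
  have /forallP/(_ (w x))/forallP/(_ x)/implyP := inj; apply.
  by rewrite wH (forallP wf).
have [x [y [xy ixy fxy]]] : exists x : 'I_n, exists y : 'I_n,
    [/\ x != y, reshape_index c x = reshape_index c y & f x = f y].
  move: ninj; rewrite negb_forall => /existsP[x].
  rewrite negb_forall => /existsP[y]; rewrite negb_imply => /andP[/andP[i j] xy].
  by exists x, y; split=> //; apply/eqP.
pose t := tperm x y; set S := \sum_(w in _ | _) _.
have tH : t \in young_group n c.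
  by rewrite inE; apply/forallP=> z; rewrite /t; case: tpermP => // ->; rewrite ixy.
have tf : fixed_by t f.
  by apply/forallP=> z; rewrite /t; case: tpermP => // ->; rewrite fxy.
suff SN : S = - S.
  have /eqP : S + S = 0 by rewrite {1}SN addNr.
  by rewrite -mulr2n mulrn_eq0 /= => /eqP.
rewrite {1}/S (reindex_inj (mulIg t)) /= -sumrN; apply: eq_big => w.
  rewrite groupMr //; congr (_ && _).
  apply/forallP/forallP=> wf z.
    by rewrite -(eqP (forallP tf _)) -permM wf.
  by rewrite permM (eqP (forallP tf _)) wf.
by move=> _; rewrite odd_permM odd_tperm xy addbT signrN.
Qed.

Lemma cfdot_perm_cf_sgn (n N : nat) (a : 'I_N -> int) (c : seq nat) :
  '[perm_cf n a, 'Ind[[set: 'S_n]] (cfSgn (young_group n c))]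
  = #|young_group n c|%:R^-1
    * (#|[set f : {ffun 'I_n -> 'I_N} | has_content a f && block_injective c f]|)%:R.
Proof.
rewrite -cfdot_Res_l cfdotE; congr (_ * _).
transitivity (\sum_(w in young_group n c)
    \sum_(f : {ffun 'I_n -> 'I_N} | fixed_by w f)
      (has_content a f)%:R * (-1) ^+ (w : 'S_n) : algC).
  apply: eq_bigr => w wH; rewrite cfResE ?subsetT // perm_cfE cfunElock wH mulr1n.
  by rewrite rmorph_sign natr_sum mulr_suml.
rewrite (exchange_big_dep xpredT) //= -sum1_card natr_sum [RHS]big_mkcond /=.
apply: eq_bigr => f _; rewrite -mulr_sumr sum_sign_fixing inE.
by case: (has_content a f); rewrite ?mul0r // mul1r; case: block_injective.
Qed.

(** * Conjugate partitions *)

(** Transposition of the diagram of [la]. *)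
Lemma count_gt_sorted (la : seq nat) (l b : nat) :
  sorted geq la -> (l < count (fun p => b < p) la)%N = (b < nth 0 la l)%N.
Proof.
elim: la l => [|p la IHla] l pla; first by rewrite nth_nil.
have la_le q : q \in la -> (q <= p)%N.
  have /allP qp : all (geq p) la.
    by apply: order_path_min pla => x y z /= yx zy; apply: leq_trans zy yx.
  exact: qp.
have [bp|pb] := ltnP b p.
  by case: l => [|l] /=; rewrite bp //= add1n ltnS IHla // (path_sorted pla).
have -> : count (fun p => b < p)%N (p :: la) = 0%N.
  apply/eqP; rewrite -leqn0 leqNgt -has_count; apply/hasPn=> q.
  rewrite inE -leqNgt => /orP[/eqP -> // | /la_le qp]; exact: leq_trans qp pb.
apply/esym/negbTE; rewrite -leqNgt; case: l => [|l] //=.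
have [lla|lal] := ltnP l (size la); last by rewrite nth_default.
exact: leq_trans (la_le _ (mem_nth 0%N lla)) pb.
Qed.

Lemma nth_le_head (la : seq nat) (l : nat) :
  sorted geq la -> (nth 0 la l <= head 0 la)%N.
Proof.
move=> sla; rewrite leqNgt -count_gt_sorted // -nth0 -leqNgt.
by rewrite (leq_trans _ (leq0n l)) // leqNgt count_gt_sorted // ltnn.
Qed.

Lemma nth_conj_part (la : seq nat) (b : nat) :
  sorted geq la -> nth 0%N (conj_part la) b = count (fun p => b < p)%N la.
Proof.
move=> sla; have [bh|hb] := ltnP b (head 0%N la); first by rewrite nth_mkseq.
rewrite nth_default ?size_mkseq //; apply/esym/eqP.
by rewrite -leqn0 leqNgt count_gt_sorted // nth0 -leqNgt.
Qed.

Lemma lt_nth_conj_part (la : seq nat) (l b : nat) :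
  sorted geq la -> (l < nth 0 (conj_part la) b)%N = (b < nth 0 la l)%N.
Proof. by move=> sla; rewrite nth_conj_part // count_gt_sorted. Qed.

Lemma sum_lt_ord (m p : nat) : (\sum_(b < m) (b < p) = minn m p)%N.
Proof.
have [mp|pm] := leqP m p.
  rewrite -[RHS]card_ord -sum1_card; apply: eq_bigr => b _.
  by rewrite (leq_trans (ltn_ord b) mp).
rewrite -[RHS]card_ord -sum1_card (big_ord_widen m (fun=> 1%N) (ltnW pm)).
by rewrite [RHS]big_mkcond.
Qed.

Lemma sumn_conj_part (la : seq nat) :
  sorted geq la -> sumn (conj_part la) = sumn la.
Proof.
move=> sla; rewrite !sumnE big_map -[X in iota 0 X]subn0.
rewrite -/(index_iota 0 (head 0%N la)) big_mkord.
transitivity (\sum_(b < head 0%N la) \sum_(p <- la) (b < p))%N.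
  apply: eq_bigr => b _; rewrite -sum1_count big_mkcond.
  by apply: eq_bigr => p _; case: ltnP.
rewrite exchange_big big_seq [RHS]big_seq; apply: eq_bigr => p pla /=.
transitivity (minn (head 0%N la) p).
  by rewrite -sum_lt_ord.
by apply/minn_idPr; rewrite -(nth_index 0%N pla) nth_le_head.
Qed.

(** The diagram of [la] is read column by column, and each cell receives the index
    of its row. *)
Section ColumnWord.

Variables (n N : nat) (la : seq nat).
Hypotheses (sla : sorted geq la) (szN : (size la <= N)%N).
Hypothesis (sumn_c : sumn (conj_part la) = n).
Local Notation c := (conj_part la).

Lemma column_lt (x : 'I_n) : (reshape_offset c x < N)%N.
Proof.
apply: leq_trans szN.
have := @reshape_offsetP c x; rewrite sumn_c => /(_ (ltn_ord x)) lt.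
by apply: leq_trans lt _; rewrite nth_conj_part // count_size.
Qed.

Definition column_word : {ffun 'I_n -> 'I_N} := [ffun x => Ordinal (column_lt x)].

Lemma content_column_word j : content column_word j = nth 0%N la j.
Proof.
transitivity (\sum_(x < sumn c) (reshape_offset c x == j))%N.
  by rewrite sumn_c; apply: eq_bigr => x _; rewrite ffunE.
rewrite (sum_blocks (fun _ k => (k == j) : nat) (leqnn _)) size_mkseq.
transitivity (\sum_(b < head 0%N la) (b < nth 0%N la j))%N.
  apply: eq_bigr => b _; rewrite -lt_nth_conj_part //.
  have [jc | cj] := ltnP j (nth 0%N c b).
    rewrite (bigD1 (Ordinal jc)) //= eqxx big1 // => k.
    by rewrite -val_eqE /= => /negbTE ->.
  by rewrite big1 // => k _; rewrite ltn_eqF // (leq_trans (ltn_ord k)).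
by rewrite sum_lt_ord; apply/minn_idPr; apply: nth_le_head.
Qed.

Lemma column_word_injective : block_injective c column_word.
Proof.
apply/forallP=> x; apply/forallP=> y; apply/implyP=> /andP[/eqP ixy].
rewrite !ffunE -val_eqE /= => /eqP oxy; apply/eqP/val_inj => /=.
by rewrite -(reshape_indexK c x) -(reshape_indexK c y) ixy oxy.
Qed.

End ColumnWord.

(** In each block the letters smaller than [m] are distinct, so there are at most
    [m] of them, and no more than the size of the block. *)
Lemma sum_content_block_injective (n N m : nat) (c : seq nat)
    (f : {ffun 'I_n -> 'I_N}) :
  sumn c = n -> block_injective c f ->
  (\sum_(j < N | j < m) content f j <= \sum_(b < size c) minn (nth 0 c b) m)%N.
Proof.
move=> cn inj; have block := block_lt (leqnn (size c)) cn.
have -> : (\sum_(j < N | j < m) content f j = \sum_x (f x < m))%N.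
  rewrite exchange_big; apply: eq_bigr => x _.
  have [fm|mf] := ltnP (f x) m.
    by rewrite (bigD1 (f x)) //= eqxx big1 // => j /andP[_ /negbTE]; rewrite eq_sym => ->.
  by rewrite big1 // => j jm; rewrite -val_eqE /= gtn_eqF // (leq_trans jm).
rewrite (partition_big (block_word (leqnn (size c)) cn) xpredT) //=.
apply: leq_sum => b _; rewrite leq_min; apply/andP; split.
  rewrite -(content_block_word (leqnn (size c)) cn) /content big_mkcond.
  by apply: leq_sum => x _; case: eqP => // _; rewrite leq_b1.
pose D := [set x | (block_word (leqnn (size c)) cn x == b) && (f x < m)%N].
have -> : (\sum_(x | block_word (leqnn (size c)) cn x == b) (f x < m) = #|D|)%N.
  rewrite -sum1_card [RHS]big_mkcond [LHS]big_mkcond; apply: eq_bigr => x _.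
  by rewrite inE; case: eqP => //= _; case: ltnP.
case: m @D => [|m] D.
  by rewrite leqn0 cards_eq0; apply/eqP/setP=> x; rewrite !inE andbF.
rewrite -[leqRHS](card_ord m.+1).
have injD : {in D &, injective (fun x => inord (f x) : 'I_m.+1)}.
  move=> x y; rewrite !inE => /andP[/eqP bx fx] /andP[/eqP y_b fy] /(congr1 val) /=.
  rewrite !inordK // => /val_inj fxy; apply/eqP.
  have /forallP/(_ x)/forallP/(_ y)/implyP := inj; apply.
  rewrite fxy eqxx andbT -bx in y_b *.
  by move/(congr1 val): y_b; rewrite !ffunE /= => ->.
by rewrite -(card_in_imset injD) max_card.
Qed.

(** * The Jacobi-Trudi formula *)

Definition parts (N : nat) (la : seq nat) (i : 'I_N) : int := (nth 0%N la i)%:Z.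

Lemma sum_parts (N : nat) (la : seq nat) :
  (size la <= N)%N -> \sum_(i < N) parts la i = (sumn la)%:Z.
Proof.
move=> szN; rewrite /parts -(raddf_sum Posz); congr Posz => /=.
rewrite sumnE (big_nth 0%N) big_mkord (big_ord_widen N (nth 0%N la) szN).
rewrite [RHS]big_mkcond; apply: eq_bigr => i _ /=.
by case: ltnP => // szi; rewrite nth_default.
Qed.

Lemma nth_sorted_le (la : seq nat) (i j : nat) :
  sorted geq la -> (i <= j)%N -> (nth 0 la j <= nth 0 la i)%N.
Proof.
move=> sla ij; rewrite leqNgt -count_gt_sorted //.
by rewrite -leqNgt (leq_trans _ ij) // leqNgt count_gt_sorted // ltnn.
Qed.

Lemma eq_straightens (N : nat) (u u' v v' : 'I_N -> int) (p : 'S_N) :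
  u =1 u' -> v =1 v' -> straightens u v p = straightens u' v' p.
Proof.
move=> uu' vv'; rewrite /straightens.
by congr (_ && _); apply: eq_forallb => i; rewrite ?vv' uu'.
Qed.

Lemma nth_le_sumn (la : seq nat) (i : nat) : (nth 0 la i <= sumn la)%N.
Proof.
have [ila|lai] := ltnP i (size la); last by rewrite nth_default.
by rewrite sumnE (big_nth 0%N) big_mkord (bigD1 (Ordinal ila)) //= leq_addr.
Qed.

(** The entries of la + delta are distinct. *)
Lemma straightens_parts (N : nat) (la : seq nat) (p : 'S_N) :
  sorted geq la -> straightens (@parts N la) (@parts N la) p = (p == 1%g).
Proof.
move=> sla; apply/andP/eqP=> [[/forallP pla _] | ->]; last first.
  split; apply/forallP=> i; first by rewrite perm1.
  by rewrite addr_ge0.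
apply/permP=> i; rewrite perm1; apply/val_inj/eqP => /=.
have := eqP (pla i); rewrite /parts.
case: ltngtP => // [pi | ip].
  by have := nth_sorted_le sla (ltnW pi); lia.
by have := nth_sorted_le sla (ltnW ip); lia.
Qed.

Lemma perm_ord1 (s : 'S_1) : s = 1%g.
Proof. by apply/permP=> i; rewrite !ord1. Qed.

(** The trivial character is the one of the partition with a single row. *)
Lemma jt_value_trivial (n : nat) (w : 'S_n) :
  jt_value (fun _ : 'I_1 => n%:Z) w = 1.
Proof.
rewrite /jt_value (bigD1 1%g) //= big1 => [|s]; last by rewrite [s]perm_ord1 eqxx.
rewrite odd_perm1 expr0 mul1r addr0.
pose f0 : {ffun 'I_n -> 'I_1} := [ffun=> ord0].
have f1 (f : {ffun 'I_n -> 'I_1}) : f = f0 by apply/ffunP=> x; rewrite !ord1.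
rewrite /num_fixed (bigD1 f0) /=; last by apply/forallP=> x; rewrite !ord1.
rewrite big1 => [|f]; last by rewrite [f]f1 eqxx andbF.
rewrite addn0 (_ : has_content _ _) //; apply/forallP=> j; rewrite /jt_index.
rewrite perm1 addrK eqz_nat -[X in _ == X](sum_content f0) big_ord1.
by rewrite [j]ord1.
Qed.

(** The formula for three factors with the trivial character as the third: there
    are no slices but the first, and only p = 1 straightens (la, la). *)
Lemma jt_cf_norm (n N : nat) (la : seq nat) :
  sorted geq la -> (size la <= N)%N -> sumn la = n ->
  '[jt_cf n (@parts N la)] = 1.
Proof.
move=> sla szN lan; pose B := (n + N)%N.
have partsB (i : 'I_N) : parts la i + (N.-1 - i)%N%:Z <= B%:Z.
  by have := nth_le_sumn la i; rewrite /parts /B; lia.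
have sum1 : \sum_(k < 1) (fun _ : 'I_1 => n%:Z) k = n%:Z by rewrite big_ord1.
have := @sum_jt_values3 n B N 0 (parts la) (parts la) (fun=> n%:Z)
  (leq_addr _ _) partsB (etrans (sum_parts szN) (congr1 Posz lan)) sum1.
under eq_bigr => w _ do rewrite jt_value_trivial mulr1.
have rows0 (m : 'I_N * 'I_N * 'I_0 -> nat) i : rows m i = 0%N.
  by rewrite /rows big1 // => j _; rewrite big_ord0.
have cols0 (m : 'I_N * 'I_N * 'I_0 -> nat) i : cols m i = 0%N.
  by rewrite /cols big1 // => j _; rewrite big_ord0.
have -> : \sum_(q : 'S_1) (-1) ^+ q *
      \sum_(T : {ffun 'I_N * 'I_N * 'I_0 -> 'I_B.+1} |
          [forall k, (slices (fun c => T c) k)%:Z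
             == jt_index (fun=> n%:Z) q (lift ord0 k)])
        \sum_(p : 'S_N) (-1) ^+ p *
          (straightens (fun i => parts la i - (rows (fun c => T c) i)%:Z)
                       (fun j => parts la j - (cols (fun c => T c) j)%:Z) p)%:R
   = 1 :> int.
  rewrite (bigD1 1%g) //= [X in _ + X]big1 => [|q]; last first.
    by rewrite [q]perm_ord1 eqxx.
  rewrite odd_perm1 expr0 mul1r addr0.
  rewrite (eq_bigl xpredT) => [|T]; last by apply/forallP=> -[].
  transitivity (\sum_(T : {ffun 'I_N * 'I_N * 'I_0 -> 'I_B.+1}) 1 : int).
    apply: eq_bigr => T _.
    have strE p : straightens (fun i => parts la i - (rows (fun c => T c) i)%:Z)
         (fun j => parts la j - (cols (fun c => T c) j)%:Z) p = (p == 1%g).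
      rewrite -(straightens_parts p sla).
      by apply: eq_straightens => i; rewrite ?rows0 ?cols0 subr0.
    rewrite (bigD1 1%g) //= big1 => [|p /negbTE p1]; last by rewrite strE p1 mulr0.
    by rewrite strE eqxx odd_perm1 expr0 mulr1 addr0.
  by rewrite sumr_const card_ffun !card_prod !card_ord muln0 expn0.
rewrite mulr1 => E; rewrite cfdotE cardsT card_Sn.
rewrite (_ : \sum_(w in _) _ = n`!%:R); last first.
  rewrite -(rmorph_nat (intmul (1 : algC))) -E rmorph_sum /=.
  apply: eq_big => [w|w _]; first by rewrite inE.
  by rewrite jt_cfE rmorphM /= [X in _ * X = _]conj_Creal // Rreal_int.
by rewrite mulVf // pnatr_eq0 -lt0n fact_gt0.
Qed.

(** The letters of [f] are distinct in each column of [la], so the content of [f]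
    is dominated by [la].  But its first m parts sum to those of [la] plus the sum
    of s(j) - j over j < m, which is nonnegative for all m and 0 for all m only
    if s = 1. *)
Lemma jt_index_block_injective (n N : nat) (la : seq nat) (s : 'S_N)
    (f : {ffun 'I_n -> 'I_N}) :
  sorted geq la -> sumn la = n ->
  has_content (jt_index (@parts N la) s) f -> block_injective (conj_part la) f ->
  s = 1%g.
Proof.
move=> sla lan /forallP fa inj.
have dom m : (m <= N)%N -> \sum_(j < N | (j < m)%N) ((s j)%:Z - j%:Z) <= 0.
  move=> mN.
  have := @sum_content_block_injective n N m (conj_part la) f.
  rewrite sumn_conj_part // => /(_ lan inj).
  rewrite (_ : \sum_(b < _) _ = \sum_(j < m) nth 0%N la j)%N; last first.
    transitivity (\sum_(b < size (conj_part la)) \sum_(j < m) (b < nth 0%N la j))%N.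
      apply: eq_bigr => b _; rewrite minnC -sum_lt_ord; apply: eq_bigr => j _.
      by rewrite lt_nth_conj_part.
    rewrite exchange_big size_mkseq; apply: eq_bigr => j _ /=.
    by rewrite sum_lt_ord; apply/minn_idPr; apply: nth_le_head.
  rewrite (big_ord_widen N (nth 0%N la) mN) -lez_nat !(raddf_sum Posz) /=.
  rewrite -subr_le0 -sumrB.
  suff -> : \sum_(j < N | (j < m)%N) ((content f j)%:Z - (nth 0%N la j)%:Z)
      = \sum_(j < N | (j < m)%N) ((s j)%:Z - j%:Z) by [].
  by apply: eq_bigr => j _; rewrite (eqP (fa j)) /jt_index /parts; lia.
suff sid k : forall j : 'I_N, (j < k)%N -> s j = j.
  by apply/permP=> j; rewrite perm1 (sid N) // ltn_ord.
elim: k => // k IHk j; rewrite ltnS leq_eqVlt => /orP[/eqP jk | /IHk //].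
have := dom k.+1; rewrite -jk ltn_ord => /(_ isT).
rewrite (bigD1 j) //= big1 => [|i /andP[ik ij]]; last first.
  rewrite IHk ?subrr // -jk; move: ik ij; rewrite ltnS leq_eqVlt -val_eqE /=.
  by case/orP=> // ->.
rewrite addr0 subr_le0 lez_nat leq_eqVlt => /orP[/eqP /val_inj // | sj].
by apply: (@perm_inj _ s); apply: IHk; rewrite -jk.
Qed.

Lemma cfSgn_char (n : nat) (G : {group 'S_n}) : cfSgn G \is a character.
Proof.
have sgn_repr : mx_repr G (fun s : 'S_n => ((-1) ^+ s)%:M : 'M[algC]_1).
  split=> [|s t _ _]; first by rewrite odd_perm1.
  by rewrite odd_permM signr_addb scalar_mxM.
suff -> : cfSgn G = cfRepr (MxRepresentation sgn_repr) by apply: cfRepr_char.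
by apply/cfunP=> s; rewrite cfunElock [RHS]cfunE mxtrace_scalar mulr1n.
Qed.

(** As chi_i is a summand of [psi], its scalar product with [phi] is at most that
    of [psi], scalar products of characters being natural numbers. *)
Lemma cfdot_char_constt0 (gT : finGroupType) (G : {group gT}) (phi psi : 'CF(G)) i :
  phi \is a character -> psi \is a character -> i \in irr_constt psi ->
  '[phi, psi] = 0 -> '[phi, 'chi_i] = 0.
Proof.
move=> Nphi Npsi /(constt_charP i Npsi)[psi' Npsi' ->]; rewrite cfdotDr => /eqP.
rewrite paddr_eq0 ?natr_ge0 ?Cnat_cfdot_char ?irr_char //.
by case/andP=> /eqP.
Qed.

(** Let chi_j be a common constituent of phi^la and of the sign character [eps]
    induced from the columns.  The terms with s <> 1 are orthogonal to [eps],
    hence to chi_j, so [jt_cf] has with chi_j the same scalar product c >= 1 as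
    phi^la.  Then the norm of jt_cf - chi_j is 2 - 2c <= 0. *)
Lemma irr_part_jt (n N : nat) (la : seq nat) :
  is_partition_of n la -> (size la <= N)%N ->
  irr_part n la = jt_cf n (@parts N la).
Proof.
case/and3P=> sla _ /eqP lan szN.
have cn : sumn (conj_part la) = n by rewrite sumn_conj_part.
pose phi := 'Ind[[set: 'S_n]] (1 : 'CF(young_group n la)).
pose eps := 'Ind[[set: 'S_n]] (cfSgn (young_group n (conj_part la))).
have phiE : phi = perm_cf n (@parts N la) by exact: Ind_young_perm_cf.
have phi_char : phi \is a character by rewrite phiE perm_cf_char.
have phi_eps : '[phi, eps] != 0.
  rewrite phiE cfdot_perm_cf_sgn mulf_neq0 ?invr_eq0 ?pnatr_eq0 -?lt0n ?cardG_gt0 //.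
  apply/card_gt0P; exists (column_word sla szN cn).
  rewrite inE column_word_injective andbT; apply/forallP=> j.
  by rewrite content_column_word.
have eps_char : eps \is a character by apply/cfInd_char/cfSgn_char.
rewrite /irr_part /irr_part_index -/phi -/eps; case: pickP => [j | none] /=.
  case/andP=> jphi jeps; set X := jt_cf n _.
  have Xj : '[X, 'chi_j] = '[phi, 'chi_j].
    rewrite /X /jt_cf cfdot_suml (bigD1 1%g) //= big1 => [|s s1].
      rewrite odd_perm1 expr0 scale1r addr0 phiE; congr '[_, _].
      apply/cfunP=> w; rewrite !perm_cfE; congr (_%:R); apply: eq_bigr => f _.
      congr nat_of_bool; apply: eq_forallb => i.
      by rewrite /jt_index perm1 addrK.
    rewrite cfdotZl (cfdot_char_constt0 (perm_cf_char _ _) eps_char jeps) ?mulr0 //.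
    rewrite cfdot_perm_cf_sgn (_ : [set f | _] = set0) ?cards0 ?mulr0 //.
    apply/setP=> f; rewrite !inE; apply/negbTE; apply: contra s1 => /andP[fa fi].
    by apply/eqP; apply: jt_index_block_injective fa fi.
  have /natrP[c cE] := Cnat_cfdot_char_irr j phi_char.
  have c_gt0 : (0 < c)%N by move: jphi; rewrite irr_consttE cE pnatr_eq0 lt0n.
  apply/esym/eqP; rewrite -subr_eq0 -cfnorm_eq0 eq_le cfnorm_ge0 andbT.
  rewrite cfnormB Xj cfnorm_irr jt_cf_norm // cE conjC_nat.
  by rewrite -natrD -[X in X - _](natrD _ 1 1) subr_le0 ler_nat leq_add.
case/negP: phi_eps; rewrite cfdot_sum_irr big1 // => i _.
have := none i; rewrite !irr_consttE; case: eqP => [-> _|_ /= /negbFE/eqP ->].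
  by rewrite mul0r.
by rewrite conjC0 mulr0.
Qed.

(** The group average of the product of the three Jacobi-Trudi sums. *)
Lemma kronecker_straightening (n N r B : nat) (la mu nu : seq nat) :
  is_partition_of n la -> is_partition_of n mu -> is_partition_of n nu ->
  (size la <= N)%N -> (size mu <= N)%N -> (size nu <= r.+1)%N -> (n + N <= B)%N ->
  kronecker n la mu nu
  = (\sum_(q : 'S_r.+1) (-1) ^+ q *
      \sum_(T : {ffun 'I_N * 'I_N * 'I_r -> 'I_B.+1} |
          [forall k, (slices (fun c => T c) k)%:Z
             == jt_index (parts nu) q (lift ord0 k)])
        \sum_(p : 'S_N) (-1) ^+ p *
          (straightens (fun i => parts la i - (rows (fun c => T c) i)%:Z)
                       (fun j => parts mu j - (cols (fun c => T c) j)%:Z) p)%:R)%:~R.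
Proof.
move=> hla hmu hnu szla szmu sznu nNB.
have [/and3P[_ _ /eqP lan] /and3P[_ _ /eqP nun]] := (hla, hnu).
rewrite /kronecker (irr_part_jt hla szla) (irr_part_jt hmu szmu) (irr_part_jt hnu sznu).
rewrite cfdotE cardsT card_Sn; set E := (X in X%:~R).
rewrite (_ : \sum_(w in _) _ = n`!%:R * E%:~R); last first.
  transitivity ((n`!%:R * E)%:~R : algC); last by rewrite rmorphM /= rmorph_nat.
  rewrite /E -(@sum_jt_values3 n B N r (parts la) (parts mu) (parts nu)).
  - rewrite rmorph_sum; apply: eq_big => [w|w _]; first by rewrite inE.
    by rewrite cfunE !jt_cfE !rmorphM /= [X in _ * X = _]conj_Creal // Rreal_int.
  - by rewrite (leq_trans _ nNB) // leq_addr.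
  - by move=> i; rewrite /parts; have := nth_le_sumn la i; lia.
  - by rewrite sum_parts // lan.
  - by rewrite sum_parts // nun.
by rewrite mulrA mulVf ?mul1r // pnatr_eq0 -lt0n fact_gt0.
Qed.

(** * Stability *)

Lemma perm_preserves (T : finType) (p : {perm T}) (S : {set T}) :
  (forall x, x \in S -> p x \in S) -> forall x, (p x \in S) = (x \in S).
Proof.
move=> pS x; have pSE : p @: S = S.
  apply/eqP; rewrite eqEcard card_imset ?leqnn ?andbT; last exact: perm_inj.
  by apply/subsetP=> _ /imsetP[y yS ->]; apply: pS.
by rewrite -[in LHS]pSE mem_imset //; apply: perm_inj.
Qed.

(** If [p] moved a position out of the first [i], it would move another one in, and
    it would reverse the order of the entries at these two positions. *)
Lemma matching_preserves_first (N i : nat) (U V : 'I_N -> int) (p : 'S_N) :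
  (forall a b : 'I_N, (a < i)%N -> (i <= b)%N -> U b < U a) ->
  (forall a b : 'I_N, (a < i)%N -> (i <= b)%N -> V b < V a) ->
  (forall a, U a = V (p a)) -> forall a, (p a < i)%N = (a < i)%N.
Proof.
move=> sepU sepV UV a; pose S := [set b : 'I_N | (b < i)%N].
suff pS b : b \in S -> p b \in S by have := perm_preserves pS a; rewrite !inE.
rewrite !inE => bi; rewrite ltnNge; apply/negP=> ipb.
have [/forallP all_out|] := boolP [forall c in ~: S, p c \in ~: S].
  have := @perm_preserves _ p (~: S) (fun c => implyP (all_out c)) b.
  by rewrite !inE -!leqNgt ipb leqNgt bi.
rewrite negb_forall_in => /existsP[c]; rewrite !inE negbK -leqNgt => /andP[ic pci].
have := lt_trans (sepU b c bi ic) _; rewrite !UV.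
by move=> /(_ _ (sepV _ _ pci ipb)); rewrite ltxx.
Qed.

(** A straightening permutation preserves the first [i] positions, before and after
    [k] is added there.  Positivity of [u] on these positions makes the addition
    harmless for the condition that the entries of u + delta are natural. *)
Lemma straightens_add_first (N i k : nat) (u v : 'I_N -> int) (p : 'S_N) :
  (forall a b : 'I_N, (a < i)%N -> (i <= b)%N -> u b <= u a) ->
  (forall a b : 'I_N, (a < i)%N -> (i <= b)%N -> v b <= v a) ->
  (forall a : 'I_N, (a < i)%N -> 0 <= u a) ->
  straightens (fun a => u a + (k * (a < i))%N%:Z) (fun a => v a + (k * (a < i))%N%:Z) p
  = straightens u v p.
Proof.
move=> sepu sepv u0; rewrite /straightens; congr (_ && _); last first.
  apply: eq_forallb => a; have [ai|ia] := ltnP a i; last by rewrite muln0 addr0.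
  by have := u0 a ai; lia.
have pres (h : nat) :
    (forall a, u a + (h * (a < i))%N%:Z - a%:Z
       = v (p a) + (h * (p a < i))%N%:Z - (p a)%:Z) ->
    forall a, (p a < i)%N = (a < i)%N.
  move=> uv; apply: (@matching_preserves_first N i
    (fun a => u a + (h * (a < i))%N%:Z - a%:Z)
    (fun a => v a + (h * (a < i))%N%:Z - a%:Z) p) => // a b ai ib.
    by have := sepu a b ai ib; rewrite ai ltnNge ib; lia.
  by have := sepv a b ai ib; rewrite ai ltnNge ib; lia.
apply/forallP/forallP=> uv a; apply/eqP; have := eqP (uv a).
  by rewrite (pres k (fun b => eqP (uv b))); lia.
have pres0 := pres 0%N; rewrite (pres0 _); first by lia.
by move=> b; rewrite !mul0n !addr0; apply/eqP.
Qed.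

(** * Adding [k] to the first [i] parts *)

Lemma size_add_first_parts (i k : nat) (la : seq nat) :
  size (add_first_parts i k la) = size la.
Proof. by rewrite size_cat size_map -size_cat cat_take_drop. Qed.

Lemma nth_add_first_parts (i k j : nat) (la : seq nat) :
  (i <= size la)%N -> nth 0%N (add_first_parts i k la) j = (nth 0 la j + k * (j < i))%N.
Proof.
move=> ila; rewrite nth_cat size_map size_takel //; have [ji|ij] := ltnP j i.
  by rewrite (nth_map 0%N) ?size_takel // nth_take // muln1.
by rewrite nth_drop subnKC // muln0 addn0.
Qed.

Lemma add_first_parts_partition (n i k : nat) (la : seq nat) :
  is_partition_of n la -> (i <= size la)%N ->
  is_partition_of (n + k * i) (add_first_parts i k la).
Proof.
case/and3P=> sla la0 /eqP lan ila; apply/and3P; split.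
- apply/(sortedP 0%N) => j _; rewrite !nth_add_first_parts //=.
  apply: leq_add; first exact: nth_sorted_le.
  by rewrite leq_mul2l; case: (ltnP j.+1 i) => [ji|_]; rewrite ?(ltnW ji) ?orbT.
- rewrite mem_cat negb_or; apply/andP; split; last first.
    by apply: contra la0 => /mem_drop.
  apply: contra la0 => /mapP[p /mem_take pla] /esym/eqP.
  by rewrite addn_eq0 => /andP[/eqP <-].
- rewrite sumn_cat -lan -{3}(cat_take_drop i la) sumn_cat addnAC eqn_add2r.
  have sum_map s : sumn [seq (p + k)%N | p <- s] = (sumn s + k * size s)%N.
    by elim: s => [|p s IHs] /=; rewrite ?muln0 // IHs mulnS; lia.
  by rewrite sum_map size_takel.
Qed.

Local Close Scope ring_scope.
Local Open Scope nat_scope.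

Theorem theorem10p2 (n : nat) (la mu nu : seq nat) (i : nat)
    (hla : is_partition_of n la) (hmu : is_partition_of n mu)
    (hnu : is_partition_of n nu)
    (hi0 : 0 < i) (hi : i <= minn (size la) (size mu))
    (hdla : depth nu <= nth 0 la i.-1 - nth 0 la i)
    (hdmu : depth nu <= nth 0 mu i.-1 - nth 0 mu i) :
  forall k : nat, 0 < k ->
    kronecker (n + k * i) (add_first_parts i k la) (add_first_parts i k mu)
      (add_first_parts 1 (k * i) nu)
    = kronecker n la mu nu.
Proof.
move=> k _; move: hi; rewrite leq_min => /andP[ila imu].
have /and3P[sla /negP la0 /eqP lan] := hla.
have /and3P[smu _ _] := hmu.
have /and3P[_ _ /eqP nun] := hnu.
have nu_gt0 : (0 < size nu).
  have la_pos : 0 < sumn la.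
    apply: leq_trans (nth_le_sumn la 0); rewrite lt0n; apply/eqP=> la00.
    by apply: la0; rewrite -la00 mem_nth // (leq_trans hi0).
  by rewrite lt0n size_eq0; apply/eqP=> nu0; move: la_pos; rewrite lan -nun nu0.
pose N := maxn (size la) (size mu); pose r := (size nu).-1.
have rE : r.+1 = size nu by rewrite prednK.
(* One bound [B] serves both partitions, so both sums run over the same arrays. *)
pose B := (n + k * i + N).
have hnu' := add_first_parts_partition (k * i) hnu nu_gt0.
rewrite muln1 in hnu'.
rewrite (@kronecker_straightening _ N r B _ _ _ (add_first_parts_partition k hla ila)
  (add_first_parts_partition k hmu imu) hnu')
  ?size_add_first_parts ?leq_maxl ?leq_maxr ?rE //.
rewrite (@kronecker_straightening _ N r B _ _ _ hla hmu hnu)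
  ?leq_maxl ?leq_maxr ?rE // /B; last by rewrite leq_add2r leq_addr.
congr (_%:~R)%R; apply: eq_bigr => q _; congr (_ * _)%R.
have jtE j : jt_index (parts (add_first_parts 1 (k * i) nu)) q (lift ord0 j)
    = jt_index (parts nu) q (lift ord0 j).
  by rewrite /jt_index /parts nth_add_first_parts // muln0 addn0.
apply: eq_big => [T | T /forallP sliceT].
  by apply: eq_forallb => j; rewrite jtE.
apply: eq_bigr => p _; congr (_ * (nat_of_bool _)%:R)%R.
(* The first entry of [jt_index] is at least the first part of [nu], so the other
   slices have total at most the depth. *)
have small : (\sum_c T c <= depth nu).
  rewrite -sum_slices -lez_nat (raddf_sum Posz) /=.
  rewrite (eq_bigr (fun j => jt_index (parts nu) q (lift ord0 j))) => [|j _]; last first.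
    by rewrite (eqP (sliceT j)) jtE.
  have := sum_jt_index (@parts r.+1 nu) q; rewrite sum_parts ?rE // big_ord_recl /=.
  have -> : jt_index (parts nu) q ord0 = ((nth 0%N nu 0)%:Z + (q ord0)%:Z)%R.
    by rewrite /jt_index subr0.
  by rewrite /depth -nth0; move: (\sum_(_ < r) _)%R => S; lia.
have rows_le a : (rows (fun c => T c) a <= depth nu).
  by apply: leq_trans small; rewrite -sum_rows (bigD1 a) //= leq_addr.
have cols_le a : (cols (fun c => T c) a <= depth nu).
  by apply: leq_trans small; rewrite -sum_cols (bigD1 a) //= leq_addr.
have lt_i a : a < i -> a <= i.-1 by move=> ai; rewrite -ltnS prednK.
have sep (d s t : nat) (ka : seq nat) (a b : nat) : sorted geq ka ->
    d <= nth 0 ka i.-1 - nth 0 ka i -> a < i -> i <= b -> s <= d ->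
    ((nth 0%N ka b)%:Z - t%:Z <= (nth 0%N ka a)%:Z - s%:Z)%R.
  move=> ska dka /lt_i ai ib sd.
  have := nth_sorted_le ska ai; have := nth_sorted_le ska ib.
  have := nth_sorted_le ska (leq_pred i); lia.
rewrite -[RHS](@straightens_add_first N i k).
- by apply: eq_straightens => a; rewrite /parts nth_add_first_parts // PoszD; lia.
- by move=> a b ai ib; apply: sep ib (rows_le a).
- by move=> a b ai ib; apply: sep ib (cols_le a).
move=> a ai; rewrite /parts subr_ge0 lez_nat; apply: leq_trans (rows_le a) _.
apply: leq_trans hdla _; apply: leq_trans (leq_subr _ _) _.
exact: nth_sorted_le sla (lt_i _ ai).
Qed.
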